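(* Let $g$ and $h$ be continuous endomorphisms of a non-commutative compact group $G$. For $z \in G$, let $f(z) = g(z)\, h(z)^{-1}$. If $f$ is a homeomorphism of $G$, then $f \in E_G(\operatorname{AF}(G))$.
   Context: For a compact group $G$: $\operatorname{Homeo}(G)$ is the set of all homeomorphisms $G \to G$; $L_x : G \to G$, $L_x(z) = xz$, is left translation by $x \in G$; $\operatorname{Aut}(G)$ is the set of all maps $G \to G$ that are both homeomorphisms and group automorphisms; $\operatorname{AF}(G) = \{L_x \circ \varphi : x \in G,\ \varphi \in \operatorname{Aut}(G)\}$ is the set of affine maps of $G$. For a set $P$ of Haar-measure-preserving homeomorphisms of $G$, the translation normalizer of $P$ is $$E_G(P) = \{ f \in \operatorname{Homeo}(G) : \text{for every } x \in G \text{ there is } p \in P \text{ with } f \circ L_x = p \circ f \}.$$ An endomorphism of $G$ is a group homomorphism $G \to G$. (Elements of $\operatorname{AF}(G)$ preserve the Haar measure.) *)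

(* Defs.v *)
From HB Require Import structures.
From mathcomp Require Import all_boot all_order all_algebra.
From mathcomp Require Import all_classical all_reals all_analysis.

Set Implicit Arguments.
Unset Strict Implicit.
Unset Printing Implicit Defensive.

Local Open Scope classical_set_scope.
Local Open Scope group_scope.

HB.structure Definition PreTopologicalGroup := {G of Topological G & Group G}.

HB.mixin Record PreTopologicalGroup_isTopologicalGroup G
    & PreTopologicalGroup G := {
  mulg_continuous : continuous (fun x : G * G => x.1 * x.2) ;
  invg_continuous : continuous (fun x : G => x^-1) ;
}.

#[short(type="topologicalGroupType")]
HB.structure Definition TopologicalGroup :=
  {G of PreTopologicalGroup G & PreTopologicalGroup_isTopologicalGroup G}.

(* Self-maps of G are plain functions G -> G; Homeo, Aut, AF and E_G are sets
   of such functions, compared by Leibniz equality. *)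

Definition Homeo (G : topologicalType) : set (G -> G) :=
  [set f | continuous f /\
    exists k : G -> G, [/\ cancel f k, cancel k f & continuous k]].

Definition ltrans (G : topologicalGroupType) (x : G) : G -> G :=
  fun z => x * z.

Definition Aut (G : topologicalGroupType) : set (G -> G) :=
  [set phi | Homeo phi /\ {morph phi : x y / x * y}].

Definition AF (G : topologicalGroupType) : set (G -> G) :=
  [set ltrans x \o phi | x in [set: G] & phi in @Aut G].

(* The translation normalizer is of interest when the members of P are
   homeomorphisms preserving the Haar measure, as those of AF do when G is
   compact; its defining condition makes sense for any set P of self-maps. *)
Definition transl_normalizer (G : topologicalGroupType) (P : set (G -> G)) :
    set (G -> G) :=
  [set f | Homeo f /\
    forall x : G, exists2 p, P p & f \o ltrans x = p \o f].

(* Main.v *)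
Require Import Defs.
From mathcomp Require Import all_boot all_order all_algebra.
From mathcomp Require Import all_classical all_reals all_analysis.

(** Put [f z = g z * (h z)^-1]. Since [g] and [h] are homomorphisms,
    [f (x * z) = g x * g z * (h z)^-1 * (h x)^-1 = g x * f z * (h x)^-1],
    so [f] turns the left translation by [x] into the two-sided translation
    [w |-> g x * w * (h x)^-1]. Writing [g x = f x * h x] exhibits the latter
    as conjugation by [h x] followed by left translation by [f x], and
    conjugations are topological automorphisms ([inner_Aut]); hence
    two-sided translations are affine ([two_sided_transl_AF]). *)

Local Open Scope classical_set_scope.
Local Open Scope group_scope.

Definition two_sided_transl (G : topologicalGroupType) (a b : G) : G -> G :=
  fun z => a * z * b^-1.

Lemma continuousMg (T : topologicalType) (G : topologicalGroupType)
    (u v : T -> G) :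
  continuous u -> continuous v -> continuous (fun z => u z * v z).
Proof.
move=> u_cont v_cont z.
apply: (@cvg_comp _ _ _ (fun z => (u z, v z)) (fun x : G * G => x.1 * x.2)
          _ (nbhs (u z, v z))); last first.
  exact: (@mulg_continuous G (u z, v z)).
exact: (cvg_pair (u_cont z) (v_cont z)).
Qed.

Lemma two_sided_transl_continuous (G : topologicalGroupType) (a b : G) :
  continuous (two_sided_transl G a b).
Proof.
apply: continuousMg; last by move=> z; exact: cvg_cst.
by apply: continuousMg => z; [exact: cvg_cst | exact: cvg_id].
Qed.

Lemma two_sided_transl_Homeo (G : topologicalGroupType) (a b : G) :
  @Homeo G (two_sided_transl G a b).
Proof.
split; first exact: two_sided_transl_continuous.
exists (two_sided_transl G a^-1 b^-1); split.
- by move=> z; rewrite /two_sided_transl invgK !mulgA mulVg mul1g mulgVK.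
- by move=> z; rewrite /two_sided_transl invgK !mulgA mulgV mul1g mulgK.
- exact: two_sided_transl_continuous.
Qed.

Lemma inner_Aut (G : topologicalGroupType) (a : G) :
  @Aut G (two_sided_transl G a a).
Proof.
split; first exact: two_sided_transl_Homeo.
by move=> x y; rewrite /two_sided_transl !mulgA mulgVK.
Qed.

(** The factorization is
    [a * z * b^-1 = (a * b^-1) * (b * z * b^-1)]. *)
Lemma two_sided_transl_AF (G : topologicalGroupType) (a b : G) :
  @AF G (two_sided_transl G a b).
Proof.
exists (a * b^-1) => //; exists (two_sided_transl G b b).
  exact: inner_Aut.
by apply/funext => z; rewrite /= /ltrans /two_sided_transl !mulgA mulgVK.
Qed.

Theorem theorem3p1p2 (G : topologicalGroupType)
    (G_compact : compact [set: G]%classic) (G_hausdorff : hausdorff_space G)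
    (G_noncomm : ~ (forall x y : G, x * y = y * x)%g)
    (g h : {multiplicative G -> G})
    (g_cont : continuous g) (h_cont : continuous h)
    (f_homeo : @Homeo G (fun z : G => g z * (h z)^-1)%g) :
  transl_normalizer (@AF G) (fun z : G => g z * (h z)^-1)%g.
Proof.
split=> // x; exists (two_sided_transl G (g x) (h x)).
  exact: two_sided_transl_AF.
by apply/funext => z; rewrite /= /ltrans /two_sided_transl !gmulfM invgM !mulgA.
Qed.
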